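(* Let $(X,d)$ be a metric space with basepoint $e\in X$. If $(X,d)$ is complete, then $(\overline{\mathbb{N}}[X],d_\ell)$ is complete.
   Context: Let $(X,d)$ be a metric space with distinguished basepoint $e\in X$. Let $X^\ast$ be the set of sequences $\mathbf{x}=(x_i)_{i\in\mathbb{N}}$ in $X$ with $\sum_{i=1}^\infty d(x_i,e)<\infty$. For $\mathbf{x},\mathbf{y}\in X^\ast$ set $\tilde d_\ell(\mathbf{x},\mathbf{y}):=\inf_{\sigma\in S_\infty}\sum_{i=1}^\infty d(x_i,y_{\sigma(i)})$, where $S_\infty$ is the group of all bijections of $\mathbb{N}$; this is a pseudometric on $X^\ast$. Write $\mathbf{x}\sim\mathbf{y}$ if $\tilde d_\ell(\mathbf{x},\mathbf{y})=0$. The $\ell^1$-multiset space is $\overline{\mathbb{N}}[X]:=X^\ast/\sim$, and $d_\ell$ (the extended matching distance) is the metric on $\overline{\mathbb{N}}[X]$ induced by $\tilde d_\ell$. *)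

(* Defs.v *)
From HB Require Import structures.
From mathcomp Require Import all_boot all_order all_algebra generic_quotient.
From mathcomp Require Import all_classical all_reals all_analysis.

Set Implicit Arguments.
Unset Strict Implicit.
Unset Printing Implicit Defensive.

Import Order.TTheory GRing.Theory Num.Theory.
Import metricType_numDomainType.

Local Open Scope classical_set_scope.
Local Open Scope ring_scope.
Local Open Scope quotient_scope.

(* The axiom of [completeType], for spaces without a canonical [point]: [cvg F]
   is replaced by the existence of a limit. *)
Definition complete_space (T : uniformType) : Prop :=
  forall F : set_system T, ProperFilter F -> cauchy F -> exists l : T, F --> l.

(* For metric spaces this is convergence of all Cauchy sequences. *)
Lemma complete_space_seqP (R : realType) (T : metricType R) :
  complete_space T <->
  (forall u : nat -> T,
     (forall eps : R, 0 < eps -> exists N, forall m n : nat,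
        (N <= m)%N -> (N <= n)%N -> mdist (u m) (u n) < eps) ->
     exists l : T, forall eps : R, 0 < eps -> exists N, forall n : nat,
        (N <= n)%N -> mdist l (u n) < eps).
Proof.
split=> [cT u cu|cT F FF /cauchyP cF].
  have [|l ul] := cT (u @ \oo) _.
    apply/cauchyP => eps /cu[N uN]; exists (u N); exists N => // n /= Nn.
    by rewrite ballEmdist/=; exact: uN.
  exists l => eps eps0.
  have /cvgrPdist_lt/(_ _ eps0) [N _ Nl] := ul.
  by exists N => n Nn; exact: Nl.
have cF' n : exists x : T, F (ball x n.+1%:R^-1) by apply: cF; rewrite invr_gt0.
have [v vF] := choice cF'.
have inv_lt (eps : R) : 0 < eps -> exists N, forall n : nat,
    (N <= n)%N -> n.+1%:R^-1 < eps.
  move=> eps0; have [N _ Nh] := near_infty_natSinv_lt (PosNum eps0).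
  by exists N => n Nn; exact: Nh.
have [|l vl] := cT v.
  move=> eps eps0; have [|N Nh] := inv_lt (eps / 2); first by rewrite divr_gt0.
  exists N => m n Nm Nn.
  have [z []] := filter_ex (filterI (vF m) (vF n)).
  rewrite !ballEmdist/= => vmz vnz.
  rewrite (le_lt_trans (metric_triangle _ z _))// (splitr eps) ltrD//.
    by rewrite (lt_trans vmz)// Nh.
  by rewrite metric_sym (lt_trans vnz)// Nh.
exists l; apply/fcvgrPdist_lt => eps eps0.
have e20 : 0 < eps / 2 by rewrite divr_gt0.
have [N1 h1] := inv_lt _ e20; have [N2 h2] := vl _ e20.
near=> z; have : ball (v (maxn N1 N2)) (maxn N1 N2).+1%:R^-1 z by near: z.
rewrite ballEmdist/= => vz.
rewrite (le_lt_trans (metric_triangle _ (v (maxn N1 N2)) _))//.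
rewrite (splitr eps) ltrD// ?h2 ?leq_maxr//.
by rewrite (lt_trans vz)// h1// leq_maxl.
Unshelve. all: by end_near. Qed.

Section l1_multiset_def.
Context (R : realType) (X : metricType R) (e : X).
Local Open Scope ereal_scope.

Definition l1_summable (x : nat -> X) : bool :=
  `[< \sum_(0 <= i <oo) (mdist (x i) e)%:E < +oo >].

Definition l1_seq : Type := {x : nat -> X | l1_summable x}.

HB.instance Definition _ := Choice.on l1_seq.

Definition match_cost (x y : nat -> X) (s : nat -> nat) : \bar R :=
  \sum_(0 <= i <oo) (mdist (x i) (y (s i)))%:E.

Definition match_edist (x y : nat -> X) : \bar R :=
  ereal_inf [set match_cost x y s | s in [set s : nat -> nat | bijective s]].

Lemma match_cost_ge0 x y s : 0 <= match_cost x y s.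
Proof. by apply: nneseries_ge0 => n _ _; rewrite lee_fin mdist_ge0. Qed.

Lemma match_edist_ge0 x y : 0 <= match_edist x y.
Proof. by apply: le_ereal_inf_tmp => _ [s _ <-]; exact: match_cost_ge0. Qed.

Lemma reindex_nneseries (a : nat -> \bar R) (s : nat -> nat) :
  bijective s -> (forall n, 0 <= a n) ->
  \sum_(0 <= i <oo) a (s i) = \sum_(0 <= i <oo) a i.
Proof.
move=> bs a0; rewrite !nneseries_esumT//.
by rewrite [RHS](reindex_esum [set: nat] [set: nat] s)//; rewrite setTT_bijective.
Qed.

Lemma match_edistxx x : match_edist x x = 0.
Proof.
apply/eqP; rewrite eq_le match_edist_ge0 andbT.
apply: ereal_inf_lbound; exists id => /=; first by exists id.
by apply: eseries0 => i _ _; rewrite mdistxx.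
Qed.

Lemma match_edist_sym x y : match_edist x y = match_edist y x.
Proof.
suff le_xy u v : match_edist u v <= match_edist v u.
  by apply/eqP; rewrite eq_le !le_xy.
apply: le_ereal_inf_tmp => _ [s bs <-]; apply: ereal_inf_lbound.
have [t st ts] := bs; exists t => /=; first by exists s.
rewrite /match_cost -[LHS](@reindex_nneseries _ s)//; last first.
  by move=> n; rewrite lee_fin mdist_ge0.
by apply: eq_eseriesr => i _; rewrite st metric_sym.
Qed.

Lemma match_edist_triangle y x z :
  match_edist x z <= match_edist x y + match_edist y z.
Proof.
apply/lee_addgt0Pr => eps eps0.
have [->|xy] := eqVneq (match_edist x y) +oo.
  by rewrite addye ?gt_eqF ?(lt_le_trans _ (match_edist_ge0 _ _))// leey.
have [->|yz] := eqVneq (match_edist y z) +oo.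
  by rewrite addey ?gt_eqF ?(lt_le_trans _ (match_edist_ge0 _ _))// leey.
have e20 : (0 < eps / 2)%R by rewrite divr_gt0.
have xyf : match_edist x y \is a fin_num.
  by rewrite ge0_fin_numE ?match_edist_ge0// ltey.
have yzf : match_edist y z \is a fin_num.
  by rewrite ge0_fin_numE ?match_edist_ge0// ltey.
have [_ [s bs <-] hs] := lb_ereal_inf_adherent e20 xyf.
have [_ [t bt <-] ht] := lb_ereal_inf_adherent e20 yzf.
rewrite [in leRHS](splitr eps) EFinD addeACA.
apply: (@le_trans _ _ (match_cost x y s + match_cost y z t)); last first.
  by apply: leeD; exact: ltW.
apply: (@le_trans _ _ (match_cost x z (t \o s))).
  by apply: ereal_inf_lbound; exists (t \o s) => //=; exact: bij_comp.
have -> : match_cost y z t =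
    \sum_(0 <= i <oo) (mdist (y (s i)) (z (t (s i))))%:E.
  rewrite (@reindex_nneseries (fun n => (mdist (y n) (z (t n)))%:E) s bs)//.
  by move=> n; rewrite lee_fin mdist_ge0.
rewrite -nneseriesD; [|by move=> *; rewrite lee_fin mdist_ge0..].
apply: lee_nneseries => [*|n _]; first by rewrite lee_fin mdist_ge0.
by rewrite -EFinD lee_fin metric_triangle.
Qed.

Lemma match_edist_fin_num (x y : l1_seq) :
  match_edist (val x) (val y) \is a fin_num.
Proof.
rewrite ge0_fin_numE ?match_edist_ge0//.
have /asboolP xe := valP x; have /asboolP ye := valP y.
apply: (@le_lt_trans _ _ (match_cost (val x) (val y) id)).
  by apply: ereal_inf_lbound; exists id => //=; exists id.
apply: le_lt_trans (lte_add_pinfty xe ye).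
rewrite -nneseriesD; [|by move=> *; rewrite lee_fin mdist_ge0..].
apply: lee_nneseries => [*|n _]; first by rewrite lee_fin mdist_ge0.
rewrite -EFinD lee_fin (le_trans (metric_triangle _ e _))//.
by rewrite (metric_sym e).
Qed.

(* [fine] loses nothing here, by [match_edist_fin_num]. *)
Definition match_dist (x y : l1_seq) : R := fine (match_edist (val x) (val y)).

Lemma match_distxx x : match_dist x x = 0%R.
Proof. by rewrite /match_dist match_edistxx. Qed.

Lemma match_dist_sym x y : match_dist x y = match_dist y x.
Proof. by rewrite /match_dist match_edist_sym. Qed.

Lemma match_dist_ge0 x y : (0 <= match_dist x y)%R.
Proof. by rewrite fine_ge0// match_edist_ge0. Qed.

Lemma match_dist_triangle y x z :
  (match_dist x z <= match_dist x y + match_dist y z)%R.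
Proof.
rewrite -lee_fin EFinD !fineK ?match_edist_fin_num//.
exact: match_edist_triangle.
Qed.

Definition match_eq (x y : l1_seq) : bool := match_dist x y == 0%R.

Lemma match_eq_refl : reflexive match_eq.
Proof. by move=> x; rewrite /match_eq match_distxx. Qed.

Lemma match_eq_sym : symmetric match_eq.
Proof. by move=> x y; rewrite /match_eq match_dist_sym. Qed.

Lemma match_eq_trans : transitive match_eq.
Proof.
move=> y x z /eqP xy /eqP yz; rewrite /match_eq eq_le match_dist_ge0 andbT.
by rewrite (le_trans (match_dist_triangle y _ _))// xy yz addr0.
Qed.

Canonical match_equiv : equiv_rel l1_seq :=
  EquivRel match_eq match_eq_refl match_eq_sym match_eq_trans.

Definition l1_multiset : Type := {eq_quot match_equiv}.

HB.instance Definition _ := Choice.on l1_multiset.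
HB.instance Definition _ := Quotient.on l1_multiset.

Definition l1_mdist (u v : l1_multiset) : R := match_dist (repr u) (repr v).

Lemma l1_mdist_pi (x y : l1_seq) :
  l1_mdist (\pi_l1_multiset x) (\pi_l1_multiset y) = match_dist x y.
Proof.
have pi0 z : match_dist z (repr (\pi_l1_multiset z)) = 0%R.
  by apply/eqP; have /eqquotP : z = repr (\pi_l1_multiset z) %[mod l1_multiset]
    by rewrite reprK.
have le_repr x' y' z w : match_dist x' z = 0%R -> match_dist y' w = 0%R ->
    (match_dist x' y' <= match_dist z w)%R.
  move=> xz yw; rewrite (le_trans (match_dist_triangle z _ _))// xz add0r.
  by rewrite (le_trans (match_dist_triangle w _ _))// (match_dist_sym w) yw addr0.
apply/eqP; rewrite eq_le; apply/andP; split; apply: le_repr => //.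
  by rewrite match_dist_sym.
by rewrite match_dist_sym.
Qed.

Lemma l1_mdistxx u : l1_mdist u u = 0%R.
Proof. exact: match_distxx. Qed.

Lemma l1_mdist_positivity u v : l1_mdist u v = 0%R -> u = v.
Proof.
by move=> /eqP uv; rewrite -(reprK u) -(reprK v); apply/eqquotP.
Qed.

Lemma l1_mdist_sym u v : l1_mdist u v = l1_mdist v u.
Proof. exact: match_dist_sym. Qed.

Lemma l1_mdist_triangle v u w : (l1_mdist u w <= l1_mdist u v + l1_mdist v w)%R.
Proof. exact: match_dist_triangle. Qed.

HB.instance Definition _ := @isMetric.Build R l1_multiset l1_mdist
  l1_mdistxx l1_mdist_positivity l1_mdist_sym l1_mdist_triangle.

End l1_multiset_def.

(* Main.v *)
Require Import Defs.
From mathcomp Require Import all_boot all_order all_algebra.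
From mathcomp Require Import all_classical all_reals all_analysis.

(** Write [h] for one half.  A metric space is complete as soon as every
sequence with [d(u_n, u_(n+1)) < h^(n+1)] has a limit [l] with
[d(u_k, l) <= h^k] ([complete_space_half]), because every Cauchy sequence has
such a subsequence.  Let then [w_n] be representatives, in the space of
summable sequences, of consecutive multisets at such small distances.  The
infimum over bijections need not be attained, but the inequality is strict, so
some bijection [s_n] matches [w_n] with [w_(n+1)] at cost below [h^(n+1)].

Permuting the entries of a representative does not change its multiset.
Permuting [w_n] by [s_(n-1) o ... o s_0] therefore yields new representatives
[y_n] for which the identity matching already costs less than [h^(n+1)]
([align_matchings]).  The problem has become the completeness of an l^1 space
of [X]-valued sequences ([l1_fast_limit]): each coordinate [n |-> y_n i] is
Cauchy in [X], hence converges to some [l i].  For a fixed number of coordinates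
the partial sum of the distances from [y_k] to [y_m] is at most [h^k] for all
[m >= k]; letting [m] grow first and the number of coordinates afterwards
bounds the identity matching of [y_k] with [l] by [h^k].  The triangle
inequality through [y_0] shows that [l] is summable, and its class is the
limit. *)

Set Implicit Arguments.
Unset Strict Implicit.
Unset Printing Implicit Defensive.

Import Order.TTheory GRing.Theory Num.Theory.
Import metricType_numDomainType.

Local Open Scope classical_set_scope.
Local Open Scope ring_scope.
Local Open Scope quotient_scope.

Lemma half_expr_lt {R : realType} (eps : R) :
  0 < eps -> exists k, 2^-1 ^+ k < eps.
Proof.
move=> eps0.
have h1 : `|2^-1 : R| < 1 by rewrite ger0_norm ?invr_ge0// invf_lt1 ?ltr1n.
have /cvgr0_norm_lt/(_ _ eps0)[N _ /(_ N (leqnn N))/=] := cvg_expr h1.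
by rewrite ger0_norm ?exprn_ge0 ?invr_ge0// => hN; exists N.
Qed.

(** Stated for a bare function [D] rather than a metric because it is applied
to the pseudometrics that compare only finitely many coordinates. *)
Lemma half_steps_bound {R : realType} (T : Type) (D : T -> T -> R)
    (u : nat -> T) :
  (forall x, D x x = 0) -> (forall y x z, D x z <= D x y + D y z) ->
  (forall n, D (u n) (u n.+1) <= 2^-1 ^+ n.+1) ->
  forall k m, (k <= m)%N -> D (u k) (u m) <= 2^-1 ^+ k.
Proof.
move=> Dxx Dtri Du k m /subnK <-; move: (m - k)%N => p.
(* The telescoped bound keeps the geometric remainder that the induction needs. *)
suff le_p : D (u k) (u (p + k)%N) <= 2^-1 ^+ k - 2^-1 ^+ (p + k).
  by rewrite (le_trans le_p)// gerBl exprn_ge0// invr_ge0.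
elim: p => [|p IHp]; first by rewrite add0n Dxx subrr.
rewrite (le_trans (Dtri (u (p + k)%N) _ _))// addSn.
rewrite (le_trans (lerD IHp (Du _)))// -addrA lerD2l exprS.
by rewrite {1}(splitr (2^-1 ^+ (p + k))) mulrC opprD addrNK.
Qed.

Lemma complete_space_half {R : realType} (T : metricType R) :
  (forall u : nat -> T, (forall n, mdist (u n) (u n.+1) < 2^-1 ^+ n.+1) ->
    exists l, forall k, mdist (u k) l <= 2^-1 ^+ k) ->
  complete_space T.
Proof.
move=> cT; apply/complete_space_seqP => u cu.
have h0 n : 0 < 2^-1 ^+ n :> R by rewrite exprn_gt0// invr_gt0.
have [N uN] := choice (fun n => cu _ (h0 n.+1)).
(* Partial sums of [N] form a nondecreasing sequence above [N]. *)
pose M n := (\sum_(i < n.+1) N i)%N.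
have NM n : (N n <= M n)%N by rewrite /M big_ord_recr leq_addl.
have MS n : (M n <= M n.+1)%N by rewrite {2}/M big_ord_recr leq_addr.
have [n|l ul] := cT (u \o M); first by apply: uN; rewrite ?(leq_trans _ (MS n)).
exists l => eps eps0.
have [k hk] := half_expr_lt (divr_gt0 eps0 (ltr0Sn _ 1)).
exists (M k) => n Mn.
rewrite (le_lt_trans (metric_triangle _ (u (M k)) _))// (splitr eps).
rewrite ltrD//; first by rewrite metric_sym (le_lt_trans (ul k)).
rewrite (lt_trans (uN k _ _ _ _)) ?(leq_trans _ Mn)//.
rewrite (le_lt_trans _ hk)// exprS ler_piMl ?ltW//.
by rewrite invf_lt1 ?ltr1n.
Qed.

Section l1_limit.
Context {R : realType} {X : metricType R}.
Implicit Types (x y : nat -> X) (s t : nat -> nat).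

Lemma match_cost_leP x y s (c : R) :
  (match_cost x y s <= c%:E)%E <->
  forall N, \sum_(i < N) mdist (x i) (y (s i)) <= c.
Proof.
have d0 i : (0 <= (mdist (x i) (y (s i)))%:E)%E by rewrite lee_fin mdist_ge0.
split=> [xyc N|xyc].
  rewrite -lee_fin (le_trans _ xyc)// -sumEFin.
  by rewrite -(big_mkord predT (fun i => (mdist (x i) (y (s i)))%:E))
    nneseries_lim_ge.
apply: lime_le; first by apply: is_cvg_nneseries.
by apply: nearW => N; rewrite big_mkord sumEFin lee_fin.
Qed.

(** Convergence in each coordinate is uniform over finitely many of them, which
is what lets the partial sums of [l1_fast_limit] pass to the limit. *)
Lemma coord_limit_near (y : nat -> nat -> X) (l : nat -> X) :
  (forall i (eps : R), 0 < eps -> exists M, forall m : nat,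
     (M <= m)%N -> mdist (l i) (y m i) < eps) ->
  forall (N : nat) (eps : R), 0 < eps -> exists M, forall m : nat,
     (M <= m)%N -> \sum_(i < N) mdist (y m i) (l i) <= eps.
Proof.
move=> yl; elim=> [|N IHN] eps eps0.
  by exists 0%N => m _; rewrite big_ord0 ltW.
have e20 : 0 < eps / 2 by rewrite divr_gt0.
have [M1 h1] := IHN _ e20; have [M2 h2] := yl N _ e20.
exists (maxn M1 M2) => m; rewrite geq_max => /andP[m1 m2].
by rewrite big_ord_recr/= (splitr eps) lerD ?h1// metric_sym ltW// h2.
Qed.

Lemma l1_fast_limit (y : nat -> nat -> X) :
  complete_space X ->
  (forall k, (match_cost (y k) (y k.+1) id <= (2^-1 ^+ k.+1)%:E)%E) ->
  exists l, forall k, (match_cost (y k) l id <= (2^-1 ^+ k)%:E)%E.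
Proof.
move=> /complete_space_seqP cX yS.
have yle N k m : (k <= m)%N ->
    \sum_(i < N) mdist (y k i) (y m i) <= 2^-1 ^+ k.
  apply: (@half_steps_bound _ _
    (fun x z : nat -> X => \sum_(i < N) mdist (x i) (z i))).
  - by move=> x; rewrite big1// => i _; rewrite mdistxx.
  - by move=> z x v; rewrite -big_split ler_sum// => i _; exact: metric_triangle.
  - by move=> n; have /match_cost_leP := yS n; apply.
have ycoord i k m : (k <= m)%N -> mdist (y k i) (y m i) <= 2^-1 ^+ k.
  move=> /(yle i.+1); apply: le_trans.
  by rewrite big_ord_recr lerDr sumr_ge0// => j _; exact: mdist_ge0.
have lim i : exists a : X, forall eps : R, 0 < eps -> exists M, forall m : nat,
    (M <= m)%N -> mdist a (y m i) < eps.
  apply: cX => eps eps0.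
  have [k hk] := half_expr_lt (divr_gt0 eps0 (ltr0Sn _ 1)).
  exists k => m n km kn; rewrite (le_lt_trans (metric_triangle _ (y k i) _))//.
  rewrite (splitr eps) ltrD//; last by rewrite (le_lt_trans (ycoord _ _ _ kn)).
  by rewrite metric_sym (le_lt_trans (ycoord _ _ _ km)).
have [l yl] := choice lim.
exists l => k; apply/match_cost_leP => N; apply/ler_addgt0Pr => eps eps0.
have [M hM] := coord_limit_near yl N eps0.
apply: le_trans (lerD (yle N k (maxn k M) (leq_maxl _ _))
  (hM (maxn k M) (leq_maxr _ _))).
by rewrite -big_split ler_sum// => i _; exact: metric_triangle.
Qed.

Lemma match_cost_comp x y s t :
  bijective t -> match_cost (x \o t) (y \o s \o t) id = match_cost x y s.
Proof.
move=> bt; rewrite /match_cost.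
rewrite -[RHS](@reindex_nneseries _ (fun i => (mdist (x i) (y (s i)))%:E) t)//.
by move=> i; rewrite lee_fin mdist_ge0.
Qed.

(** The permutation of [x] is undone by using its inverse as the matching. *)
Lemma match_edist_le_cost x y t :
  bijective t -> (match_edist x y <= match_cost (x \o t) y id)%E.
Proof.
move=> [t' tK t'K]; apply: ereal_inf_lbound.
exists t'; first by exists t.
rewrite -(@match_cost_comp x y t' t); last by exists t'.
by apply: eq_eseriesr => i _ /=; rewrite tK.
Qed.

(** The permutations are built recursively: once [w k] has been permuted, the
chosen matching of [w k] with [w k.+1] is transported along. *)
Lemma align_matchings (w : nat -> nat -> X) (c : nat -> \bar R) :
  (forall k, (match_edist (w k) (w k.+1) < c k)%E) ->
  exists t : nat -> nat -> nat, forall k, bijective (t k) /\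
    (match_cost (w k \o t k) (w k.+1 \o t k.+1) id < c k)%E.
Proof.
move=> wc.
have cheap k : exists s, bijective s /\ (match_cost (w k) (w k.+1) s < c k)%E.
  have [_ [s bs <-] sc] := ereal_inf_lt (wc k).
  by exists s.
have [s sP] := choice cheap.
pose t := fix t k := if k is j.+1 then s j \o t j else id.
have bt k : bijective (t k).
  elim: k => [|k IHk] /=; first by exists id.
  by apply: bij_comp => //; case: (sP k).
exists t => k; split => //.
have -> : w k.+1 \o t k.+1 = w k.+1 \o s k \o t k by [].
by rewrite match_cost_comp//; case: (sP k).
Qed.

Lemma l1_summable_near (e : X) x y :
  l1_summable e x -> (match_cost x y id < +oo)%E -> l1_summable e y.
Proof.
move=> /asboolP xe xy; apply/asboolP.
apply: le_lt_trans (lte_add_pinfty xy xe).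
rewrite -nneseriesD; [|by move=> *; rewrite lee_fin mdist_ge0..].
apply: lee_nneseries => [*|n _]; first by rewrite lee_fin mdist_ge0.
by rewrite -EFinD lee_fin (metric_sym (x n)) metric_triangle.
Qed.

Lemma l1_summable_comp (e : X) x t :
  bijective t -> l1_summable e x -> l1_summable e (x \o t).
Proof.
move=> bt /asboolP xe; apply/asboolP.
rewrite (@reindex_nneseries _ (fun i => (mdist (x i) e)%:E) t)//.
by move=> i; rewrite lee_fin mdist_ge0.
Qed.

End l1_limit.

Theorem proposition4p8 (R : realType) (X : metricType R) (e : X) :
  complete_space X -> complete_space (l1_multiset e).
Proof.
move=> cX; apply: complete_space_half => u uS.
pose w k : l1_seq e := repr (u k).
have wS k : (match_edist (val (w k)) (val (w k.+1)) < (2^-1 ^+ k.+1)%:E)%E.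
  by rewrite -(fineK (match_edist_fin_num _ _)) lte_fin; exact: uS.
have [t tP] := align_matchings wS.
have [k|l yl] := @l1_fast_limit _ _ (fun k => val (w k) \o t k) cX.
  by apply: ltW; case: (tP k).
have le_l : l1_summable e l.
  apply: (@l1_summable_near _ _ e (val (w 0%N) \o t 0%N)).
    by apply: l1_summable_comp; [case: (tP 0%N)|exact: valP].
  by rewrite (le_lt_trans (yl 0%N))// ltry.
exists (\pi_(l1_multiset e) (exist _ l le_l)) => k.
rewrite -[u k]reprK [leLHS]l1_mdist_pi -lee_fin fineK ?match_edist_fin_num//.
by apply: le_trans (yl k); apply: match_edist_le_cost; case: (tP k).
Qed.
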